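(* Let $V=V_1\uplus\cdots\uplus V_k$ be a finite ground set partitioned into disjoint nonempty sets, let $b_1,\dots,b_k$ be integers with $1\le b_i\le |V_i|$, let $n=|V|$, $b=\sum_i b_i$, $\hat b=\min_i b_i$, and let $f:2^V\to\mathbb{R}_{\ge0}$ be monotone with $f(\emptyset)=0$, with PM diminishing-return ratio $\gamma$ and PM curvature $\alpha$ (defined in the context). Let $\epsilon\in[0,1]$, let $S$ be the output of \textsc{ThrGreedy} (described in the context) with parameter $\epsilon$, and let $S^*$ maximize $f$ over $\{S\subseteq V:|S\cap V_i|\le b_i\ \forall i\}$. Then \textsc{ThrGreedy} obtains a $\min\big(\frac{1}{r_1^{(t)}},\frac{1}{r_2^{(t)}}\big)$-approximation solution, i.e. $f(S^* )\le\min\big(\frac{1}{r_1^{(t)}},\frac{1}{r_2^{(t)}}\big)f(S)$, where $$r_1^{(t)}=\frac{\gamma(1-\epsilon)^2}{1+\gamma\alpha(1-\epsilon)},\qquad r_2^{(t)}=\frac1\alpha\Big[1-\Big(1-\frac{\alpha\gamma(1-\epsilon)}{b}\Big)^{\hat b}\Big],$$ and \textsc{ThrGreedy} uses $O(\frac n\epsilon\ln b)$ queries of $f$.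
   Context: $\Delta_e f(S):=f(S\cup\{e\})-f(S)$. The PM diminishing-return ratio $\gamma$ is the maximum value in $[0,1]$ with $\Delta_e f(T)\le\frac1\gamma\Delta_e f(S)$ for all $S\subseteq T\subseteq V$ with $|(T\setminus S)\cap V_i|\le b_i\ \forall i\in[k]$ and all $e\in V\setminus T$; the PM curvature $\alpha$ is the minimum value in $[0,1]$ with $\Delta_e f(T)\ge(1-\alpha)\Delta_e f(S)$ for all such $S,T,e$. Algorithm \textsc{ThrGreedy} (parameter $\epsilon$): set $I=[k]$, $S_0=\emptyset$, $t=0$, $\tau=\tau_0=\max_{e\in V}\Delta_e f(S_0)$. While $I\neq\emptyset$ and $\tau\ge\frac{\epsilon(1-\epsilon)\tau_0}{b}$: for each $i\in I$ and $e\in V_i\setminus S_t$ (scanned in turn): if $\Delta_e f(S_t)\ge\tau$ then set $S_{t+1}=S_t\cup\{e\}$, $t=t+1$, and if $|S_t\cap V_i|\ge b_i$ remove $i$ from $I$; after the scan set $\tau=\tau(1-\epsilon)$. Return $S_t$.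
   Formalization: The query bound is for ε>0, ε fixed: an absolute constant once b≥b₀(ε), and a constant depending on ε for all b≥2 (a uniform one fails). r₂ at α=0 is its limit; if γ(1-ε)=0 the ratio is +∞ (no guarantee); at ε=0 the guarantee holds if the algorithm returns. *)

(* Defs.v *)
From HB Require Import structures.
From mathcomp Require Import all_boot all_order all_algebra.
From mathcomp Require Import reals ereal exp.

Set Implicit Arguments.
Unset Strict Implicit.
Unset Printing Implicit Defensive.

Import Order.TTheory GRing.Theory Num.Theory.
Local Open Scope ring_scope.

Record pm_instance (R : realType) := PMInstance {
  ground : finType;
  nparts : nat;
  part : 'I_nparts -> {set ground};
  budget : 'I_nparts -> nat;
  objective : {set ground} -> R;
  nparts_gt0 : (0 < nparts)%N;
  part_nonempty : forall i, part i != set0;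
  part_disjoint : forall i j, i != j -> [disjoint part i & part j];
  part_cover : forall e, exists i, e \in part i;
  budget_bounds : forall i, (1 <= budget i <= #|part i|)%N;
  objective_ge0 : forall A, 0 <= objective A;
  objective_mono : forall A B : {set ground}, A \subset B ->
    objective A <= objective B;
  objective_set0 : objective set0 = 0 }.

Section Instance.
Variables (R : realType) (X : pm_instance R).
Implicit Types (A B : {set ground X}) (e : ground X) (i : 'I_(nparts X)).

Definition total_budget : nat := (\sum_(i < nparts X) budget i)%N.

(* The sum of the b_i dominates each b_i, so it is neutral for the minimum. *)
Definition min_budget : nat := \big[minn/total_budget]_(i < nparts X) budget i.

Definition gain e A : R := objective (e |: A) - objective A.

Definition feasible A : Prop :=
  forall i, (#|A :&: part i| <= budget i)%N.

Definition optimal A : Prop :=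
  feasible A /\ forall B, feasible B -> objective B <= objective A.

Definition pm_triple A B e : Prop :=
  [/\ A \subset B, feasible (B :\: A) & e \notin B].

(* With 1/0 read as +oo, the value g = 0 imposes no constraint. *)
Definition dr_admissible (g : R) : Prop :=
  g != 0 -> forall A B e, pm_triple A B e -> gain e B <= g^-1 * gain e A.

Definition is_dr_ratio (g : R) : Prop :=
  [/\ 0 <= g <= 1, dr_admissible g
    & forall g', 0 <= g' <= 1 -> dr_admissible g' -> g' <= g].

Definition curv_admissible (a : R) : Prop :=
  forall A B e, pm_triple A B e -> (1 - a) * gain e A <= gain e B.

Definition is_curvature (a : R) : Prop :=
  [/\ 0 <= a <= 1, curv_admissible a
    & forall a', 0 <= a' <= 1 -> curv_admissible a' -> a <= a'].

Record thr_state := ThrState {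
  active : {set 'I_(nparts X)};
  sol : {set ground X};
  tau : R;
  queries : nat }.

(* All singleton gains are nonnegative, so 0 is neutral for the maximum. *)
Definition tau0 : R := \big[Num.max/0]_e gain e set0.

(* Every evaluation of a gain is charged two queries of the objective. *)
Definition thr_init : thr_state :=
  ThrState [set: _] set0 tau0 (2 * #|ground X|).

(* An index deactivated during a scan is skipped for the rest of that scan. *)
Definition thr_visit (st : thr_state) (p : 'I_(nparts X) * ground X) :
    thr_state :=
  let: (i, e) := p in
  if (i \in active st) && (e \in part i :\: sol st) then
    if tau st <= gain e (sol st) then
      let S' := e |: sol st in
      ThrState
        (if (budget i <= #|S' :&: part i|)%N then active st :\ i
         else active st)
        S' (tau st) (queries st + 2)
    else ThrState (active st) (sol st) (tau st) (queries st + 2)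
  else st.

Definition thr_guard (eps : R) (st : thr_state) : bool :=
  (active st != set0) &&
  (eps * (1 - eps) * tau0 / total_budget%:R <= tau st).

Definition thr_round (eps : R) (s : seq ('I_(nparts X) * ground X))
    (st : thr_state) : thr_state :=
  let st' := foldl thr_visit st s in
  ThrState (active st') (sol st') (tau st' * (1 - eps)) (queries st').

(* The r-th scan visits the pairs (i, e) with e in V_i in the order ord r; *)
(* the orders are arbitrary and may change from one scan to the next. *)
Definition scan_orders (ord : nat -> seq ('I_(nparts X) * ground X)) : Prop :=
  forall r, perm_eq (ord r)
    (enum [pred p : 'I_(nparts X) * ground X | p.2 \in part p.1]).

Fixpoint thr_run (eps : R) (ord : nat -> seq ('I_(nparts X) * ground X))
    (r : nat) : thr_state :=
  if r is r'.+1 then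
    let st := thr_run eps ord r' in
    if thr_guard eps st then thr_round eps (ord r') st else st
  else thr_init.

Definition thr_returns (eps : R)
    (ord : nat -> seq ('I_(nparts X) * ground X)) (st : thr_state) : Prop :=
  exists2 r, thr_run eps ord r = st & ~~ thr_guard eps st.

Definition ratio1 (gamma alpha eps : R) : R :=
  gamma * (1 - eps) ^+ 2 / (1 + gamma * alpha * (1 - eps)).

(* At alpha = 0 the formula is read as its limit when alpha tends to 0. *)
Definition ratio2 (gamma alpha eps : R) : R :=
  if alpha == 0 then gamma * (1 - eps) * min_budget%:R / total_budget%:R
  else alpha^-1 *
    (1 - (1 - alpha * gamma * (1 - eps) / total_budget%:R) ^+ min_budget).

(* The ratio +oo is no guarantee; it is singled out since +oo * 0 = 0 in *)
(* \bar R. *)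
Definition approx_solution (c : \bar R) A : Prop :=
  feasible A /\
  forall Sopt, optimal Sopt ->
    c = +oo%E \/ ((objective Sopt)%:E <= c * (objective A)%:E)%E.

End Instance.

Definition thr_queries_le (R : realType) (C eps : R) (b0 : nat) : Prop :=
  forall (X : pm_instance R)
    (ord : nat -> seq ('I_(nparts X) * ground X)) (st : thr_state X),
  (b0 <= total_budget X)%N -> scan_orders ord -> thr_returns eps ord st ->
  (queries st)%:R <= C * (#|ground X|%:R / eps) * ln (total_budget X)%:R.

(* Main.v *)
Require Import Defs.
From mathcomp Require Import all_boot all_order all_algebra.
From mathcomp Require Import reals ereal sequences exp.
From mathcomp Require Import ring lra.

Set Implicit Arguments.
Unset Strict Implicit.
Unset Printing Implicit Defensive.

Import Order.TTheory GRing.Theory Num.Theory.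
Local Open Scope ring_scope.

(** Let e_1, ..., e_m be the accepted elements in order, S_t = {e_1, ..., e_t}
and a_t = f(S_t) - f(S_(t-1)). Every element o of the optimum O that is still
available when e_t is accepted has been examined at some S_v with v < t, where
its gain was at most a_t / (1 - eps).

Insert the elements of O into the prefixes S_v at which they were examined,
the latest prefix first, and between two insertions unwind the sequence of
accepted elements. Each insertion takes place on top of S_v together with a
subset of O, hence on top of a feasible increment of S_v, so it costs at most
1/gamma times the gain at S_v; unwinding e_t recovers (1 - alpha) a_t. Hence
  f(O) <= sum_(e_t in O) a_t + alpha sum_(e_t not in O) a_t
          + (1/gamma) sum_(o in O minus S) (gain of o at S_v).

For r1, in a full part the elements of O minus S are at most as many as those
of S minus O, and each gain is at most a_t / (1 - eps) for all the latter; in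
the other parts the gain is at most eps tau0 / b. For r2, the inequality at
each prefix of length below min b_i is a recursion for f(S_t); the elements of
O that are hit are dealt with by induction on b. *)

(** * Numerical estimates for the greedy recursion *)

Section Numeric.
Variable R : realType.
Implicit Types (x kappa alpha F : R).

Lemma bernoulli_ineq x l : 0 <= x <= 1 -> 1 - l%:R * x <= (1 - x) ^+ l.
Proof.
move=> /andP[x0 x1]; elim: l => [|l IH]; first by rewrite mul0r subr0 expr0.
rewrite exprS -natr1.
have h : (1 - x) * (1 - l%:R * x) <= (1 - x) * (1 - x) ^+ l.
  by apply: ler_wpM2l => //; rewrite subr_ge0.
apply: le_trans h; have := ler0n R l; nra.
Qed.

(** With [kappa] = gamma (1 - eps), this is the second ratio expanded into a geometric sum, which
    stays meaningful at [alpha = 0]. The budget [n] and the length [j] are separate arguments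
    because both vary in the induction of [greedy_growth]. *)
Definition greedy_ratio kappa alpha (n j : nat) : R :=
  kappa / n%:R * \sum_(l < j) (1 - alpha * kappa / n%:R) ^+ l.

Lemma greedy_ratio0 kappa alpha n : greedy_ratio kappa alpha n 0 = 0.
Proof. by rewrite /greedy_ratio big_ord0 mulr0. Qed.

Lemma greedy_ratioS kappa alpha n j : greedy_ratio kappa alpha n j.+1 =
  kappa / n%:R + (1 - alpha * kappa / n%:R) * greedy_ratio kappa alpha n j.
Proof.
rewrite /greedy_ratio big_ord_recl expr0 mulrDr mulr1; congr (_ + _).
rewrite [RHS]mulrCA; congr (_ * _); rewrite mulr_sumr.
by apply: eq_bigr => i _; rewrite lift0 exprS.
Qed.

Lemma mul_greedy_ratio kappa alpha n j :
  alpha * greedy_ratio kappa alpha n j =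
  1 - (1 - alpha * kappa / n%:R) ^+ j.
Proof.
rewrite /greedy_ratio; elim: j => [|j IH].
  by rewrite big_ord0 expr0 !mulr0 subrr.
rewrite big_ord_recr /= !mulrDr IH exprS; ring.
Qed.

Section Bounds.
Variables (kappa alpha : R).
Hypotheses (kappa01 : 0 <= kappa <= 1) (alpha01 : 0 <= alpha <= 1).

Lemma discount_bounds n : 0 <= 1 - alpha * kappa / n%:R <= 1.
Proof.
have [k0 k1] := andP kappa01; have [a0 a1] := andP alpha01.
have ak : 0 <= alpha * kappa by exact: mulr_ge0.
rewrite subr_ge0 lerBlDl lerDr divr_ge0 ?ler0n // andbT.
case: n => [|n]; first by rewrite invr0 mulr0.
by rewrite ler_pdivrMr ?ltr0n // mul1r (le_trans (mulr_ile1 _ _ _ _)) // ler1n.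
Qed.

Lemma greedy_ratio_ge0 n j : 0 <= greedy_ratio kappa alpha n j.
Proof.
have [k0 _] := andP kappa01; rewrite mulr_ge0 ?divr_ge0 ?ler0n //.
apply: sumr_ge0 => i _; rewrite exprn_ge0 //.
by have /andP[] := discount_bounds n.
Qed.

Lemma greedy_ratio_le n j : greedy_ratio kappa alpha n j <= kappa * j%:R / n%:R.
Proof.
have [k0 _] := andP kappa01; rewrite mulrAC /greedy_ratio.
apply: ler_wpM2l; first by rewrite divr_ge0 ?ler0n.
rewrite -[X in _ <= X%:R]card_ord -sumr_const; apply: ler_sum => i _.
by apply: exprn_ile1; have /andP[] := discount_bounds n.
Qed.

Lemma greedy_ratio_le1 n j : (j <= n)%N -> greedy_ratio kappa alpha n j <= 1.
Proof.
have [k0 k1] := andP kappa01.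
move=> jn; apply: le_trans (greedy_ratio_le n j) _.
case: n jn => [|n] jn; first by rewrite invr0 mulr0.
rewrite ler_pdivrMr ?ltr0n // mul1r.
apply: le_trans (_ : 1 * j%:R <= _); first exact: ler_wpM2r.
by rewrite mul1r ler_nat.
Qed.

(** With x = alpha kappa, the base on the right is the base on the left times 1 - d, where d = x /
    ((n + 1) (n + 2 - x)). Bernoulli bounds (1 - d)^l below by 1 - l d, and l d <= x / (n + 2)
    because l <= n and x <= 1. *)
Lemma discount_pow_le n l : (l <= n)%N ->
  (1 - alpha * kappa / n.+2%:R) ^+ l.+1 <= (1 - alpha * kappa / n.+1%:R) ^+ l.
Proof.
have [k0 k1] := andP kappa01; have [a0 a1] := andP alpha01.
set x := alpha * kappa => ln.
have x0 : 0 <= x by exact: mulr_ge0.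
have x1 : x <= 1 by exact: mulr_ile1.
have n0 : 0 <= n%:R :> R by exact: ler0n.
have ln' : l%:R <= n%:R :> R by rewrite ler_nat.
have l0 : 0 <= l%:R :> R by exact: ler0n.
rewrite -[n.+2%:R]natr1 -[n.+1%:R]natr1.
set m : R := n%:R in n0 ln' *.
pose d := x / ((m + 1) * (m + 1 + 1 - x)).
have pE : 1 - x / (m + 1) = (1 - x / (m + 1 + 1)) * (1 - d).
  by rewrite /d; field; apply/and3P; split; lra.
have den : 0 < (m + 1) * (m + 1 + 1 - x) by apply: mulr_gt0; lra.
have d01 : 0 <= d <= 1.
  rewrite /d divr_ge0 ?(ltW den) //= ler_pdivrMr // mul1r; nra.
have p0 : 0 <= 1 - x / (m + 1 + 1).
  by rewrite subr_ge0 ler_pdivrMr; lra.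
rewrite pE exprMn exprS mulrC; apply: ler_wpM2l; first exact: exprn_ge0.
apply: le_trans (bernoulli_ineq l d01).
rewrite lerD2l lerN2 /d mulrA ler_pdivrMr // mulrAC ler_pdivlMr; last lra.
rewrite -!mulrA [l%:R * _]mulrCA; apply: ler_wpM2l => //.
have : l%:R * (m + 1 + 1) <= m * (m + 1 + 1) by apply: ler_wpM2r => //; lra.
have : (m + 1) * x <= (m + 1) * 1 by apply: ler_wpM2l => //; lra.
nra.
Qed.

(* Covering an element of the optimum shrinks both the gap and the budget; *)
(* this inequality says that such a step is never the worst case. *)
Lemma greedy_ratio_shrink n j : (j <= n)%N ->
  (1 - alpha * kappa / n.+1%:R) * greedy_ratio kappa alpha n.+1 j <=
  (1 - kappa / n.+1%:R) * greedy_ratio kappa alpha n j.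
Proof.
have [k0 k1] := andP kappa01.
case: n => [|n] jn.
  by move: jn; rewrite leqn0 => /eqP->; rewrite !greedy_ratio0 !mulr0.
rewrite /greedy_ratio mulrCA mulrA [leRHS]mulrA.
have hs : (1 - alpha * kappa / n.+2%:R) *
    (\sum_(l < j) (1 - alpha * kappa / n.+2%:R) ^+ l) <=
    \sum_(l < j) (1 - alpha * kappa / n.+1%:R) ^+ l.
  rewrite mulr_sumr; apply: ler_sum => i _; rewrite -exprS.
  by apply: discount_pow_le; rewrite -ltnS (leq_trans (ltn_ord i)).
rewrite -mulrA; apply: ler_pM => //.
- by rewrite divr_ge0 ?ler0n.
- rewrite mulr_ge0 //; first by have /andP[] := discount_bounds n.+2.
  apply: sumr_ge0 => i _; rewrite exprn_ge0 //.
  by have /andP[] := discount_bounds n.+2.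
rewrite mulrCA; apply: ler_wpM2l => //.
have n0 : 0 <= n%:R :> R by exact: ler0n.
rewrite -[n.+2%:R]natr1 -[n.+1%:R]natr1; set m : R := n%:R + 1.
have m0 : 0 < m by rewrite /m; lra.
(* The extreme case is [kappa] = 1, where equality holds. *)
rewrite ler_pdivlMr //; apply: (@le_trans _ _ (1 - (m + 1)^-1)).
  have -> : (m + 1)^-1 * m = 1 - (m + 1)^-1 by field; rewrite gt_eqF; lra.
  by [].
by rewrite lerD2l lerN2 ler_piMl // invr_ge0; lra.
Qed.

(** Here [a t] stands for the gain of an accepted element, [hit t] for its membership in the
    optimum, and [F] for the optimal value. Removing the first step leaves the same problem with gap
    [F'] and budget [n - hit 0]. A miss reproduces the recursion of [greedy_ratio]; a hit is settled
    by [greedy_ratio_shrink]. *)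
Lemma greedy_growth M n F (a : nat -> R) (hit : nat -> bool) : (M <= n)%N ->
  0 < kappa -> (forall t, 0 <= a t) ->
  (forall t, (t < M)%N ->
    kappa * (F - \sum_(u < t) (if hit u then 1 else alpha) * a u) <=
    (n - \sum_(u < t) hit u)%:R * a t) ->
  greedy_ratio kappa alpha n M * F <= \sum_(u < M) a u.
Proof.
move=> Mn kpos; elim: M n F a hit Mn => [|M IH] n F a hit Mn a0 H.
  by rewrite greedy_ratio0 mul0r big_ord0.
have [k0 k1] := andP kappa01; have [al0 al1] := andP alpha01.
case: n Mn H => // n Mn H; rewrite ltnS in Mn.
(* The gap may become negative along the induction; [greedy_ratio_shrink] is multiplied by [F] below
   and needs its sign. *)
have [F0|F0] := leP F 0.
  apply: le_trans (_ : 0 <= _); last by apply: sumr_ge0.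
  by rewrite mulr_ge0_le0 // greedy_ratio_ge0.
have H0 : kappa / n.+1%:R * F <= a 0.
  have := H 0 isT; rewrite !big_ord0 subr0 subn0 mulrAC ler_pdivrMr ?ltr0n //.
  by rewrite [_ * a 0]mulrC.
rewrite big_ord_recl.
set F' := F - (if hit 0 then 1 else alpha) * a 0.
have {}IH : greedy_ratio kappa alpha (n.+1 - hit 0) M * F' <=
    \sum_(u < M) a u.+1.
  apply: (IH _ _ (fun u => a u.+1) (fun u => hit u.+1)) => //.
    by case: (hit 0); rewrite ?subn1 ?subn0 // leqW.
  move=> t tM; have := H t.+1 tM; rewrite !big_ord_recl /=.
  by rewrite /F' opprD addrA subnDA.
apply: le_trans (_ : a 0 + greedy_ratio kappa alpha (n.+1 - hit 0) M * F' <= _);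
  last by rewrite lerD2l.
rewrite greedy_ratioS /F'; case: (hit 0) => /=.
- rewrite subn1 mul1r /=.
  have sh := greedy_ratio_shrink Mn.
  have r1 : 0 <= 1 - greedy_ratio kappa alpha n M.
    by rewrite subr_ge0 greedy_ratio_le1.
  have h1 := ler_wpM2l r1 H0; have h2 := ler_wpM2r (ltW F0) sh.
  move: h1 h2; set g := greedy_ratio _ _ _ _; set g' := greedy_ratio _ _ _ _.
  set kn := kappa / _; set an := alpha * _ / _; move=> h1 h2.
  rewrite mulrBl mul1r in h2; lra.
- rewrite subn0.
  have r1 : 0 <= 1 - alpha * greedy_ratio kappa alpha n.+1 M.
    rewrite mul_greedy_ratio subKr exprn_ge0 //.
    by have /andP[] := discount_bounds n.+1.
  have h1 := ler_wpM2l r1 H0.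
  move: h1; set g := greedy_ratio _ _ _ _.
  rewrite -[alpha * kappa / _]mulrA; set kn := kappa / _; move=> h1.
  lra.
Qed.
End Bounds.
End Numeric.

(** * Traces *)
Section Traces.
Variables (R : realType) (X : pm_instance R).
Implicit Types (A B O P Q : {set ground X}) (e o : ground X) (l : seq (ground X)).
Notation f := (@objective R X).

Lemma gain_ge0 e A : 0 <= gain e A.
Proof. by rewrite subr_ge0 objective_mono // subsetUr. Qed.

Lemma objectiveU1 e A : f (e |: A) = f A + gain e A.
Proof. by rewrite /gain addrC subrK. Qed.

Lemma feasible_sub A B : A \subset B -> feasible B -> feasible A.
Proof.
by move=> sAB fB i; apply: leq_trans (fB i); rewrite subset_leq_card ?setSI.
Qed.

Lemma part_index_exists :
  exists pt : ground X -> 'I_(nparts X), forall e i, (e \in part i) = (pt e == i).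
Proof.
have [pt ptP] := fin_all_exists (@part_cover R X); exists pt => e i.
have [<-|ne] := eqVneq (pt e) i; first exact: ptP.
by have /disjointFr -> := part_disjoint ne.
Qed.

Lemma feasible_card A : feasible A -> (#|A| <= total_budget X)%N.
Proof.
move=> fA; have [pt ptP] := part_index_exists.
rewrite -sum1_card (partition_big pt predT) //=.
apply: leq_sum => i _; apply: leq_trans (fA i); rewrite -sum1_card.
rewrite leq_eqVlt; apply/orP; left; apply/eqP; apply: eq_bigl => e.
by rewrite inE ptP.
Qed.

(** The elements of [P] are inserted one at a time. Each lands on [A] together with a subset of
    [Q :|: P], a feasible increment of [A], so it costs at most [gamma^-1] times its gain at [A]. *)
Lemma objective_batch_le gamma A Q P : 0 < gamma -> dr_admissible X gamma ->
  feasible (Q :|: P) -> [disjoint P & A] ->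
  f (A :|: Q :|: P) <= f (A :|: Q) + gamma^-1 * \sum_(o in P) gain o A.
Proof.
move=> g0 dr; elim: {P}_.+1 {-2}P (ltnSn #|P|) => // n IH P.
have [->|[o oP]] := set_0Vmem P.
  by rewrite !setU0 big_set0 mulr0 addr0.
rewrite ltnS (cardsD1 o) oP add1n => cP feas dis.
have feas' : feasible (Q :|: P :\ o).
  by apply: feasible_sub feas; rewrite setUS // subsetDl.
have dis' : [disjoint P :\ o & A] by apply: disjointWl dis; rewrite subsetDl.
have {}IH := IH _ cP feas' dis'.
have -> : A :|: Q :|: P = o |: (A :|: Q :|: P :\ o).
  by rewrite setUCA setD1K.
rewrite (big_setD1 o) //= mulrDr addrCA addrC.
have go : 0 <= gamma^-1 * gain o A by rewrite mulr_ge0 ?invr_ge0 ?gain_ge0 ?ltW.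
have [oin|oout] := boolP (o \in A :|: Q :|: P :\ o).
  by rewrite setUC (setUidPl _) ?sub1set //; lra.
rewrite objectiveU1; suff : gain o (A :|: Q :|: P :\ o) <= gamma^-1 * gain o A.
  by lra.
apply: dr; first by rewrite gt_eqF.
split=> //; first by rewrite -setUA subsetUl.
by apply: feasible_sub feas'; rewrite -setUA setDUl setDv set0U subsetDl.
Qed.

Definition prefix_set l t : {set ground X} := [set x in take t l].

(** Indexed by the element and not by its position, so that it can be summed over sets such as
    [S :\: O]. *)
Definition step l e : R := gain e (prefix_set l (index e l)).

Lemma prefix_set0 l : prefix_set l 0 = set0.
Proof. by apply/setP => x; rewrite !inE take0. Qed.

Lemma prefix_setS e0 l t : (t < size l)%N ->
  prefix_set l t.+1 = nth e0 l t |: prefix_set l t.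
Proof.
move=> tl; apply/setP => x.
by rewrite !inE (take_nth e0) // mem_rcons inE.
Qed.

Lemma prefix_set_size l : prefix_set l (size l) = [set x in l].
Proof. by rewrite /prefix_set take_size. Qed.

Lemma prefix_set_sub l t : prefix_set l t \subset [set x in l].
Proof. by apply/subsetP => x; rewrite !inE => /mem_take. Qed.

Lemma nth_notin_prefix e0 l t : uniq l -> (t < size l)%N ->
  nth e0 l t \notin prefix_set l t.
Proof.
move=> ul tl; rewrite inE; have : uniq (take t.+1 l) by exact: take_uniq.
by rewrite (take_nth e0) // rcons_uniq => /andP[].
Qed.

Lemma mem_prefix_set l t o : o \in l -> (o \in prefix_set l t) = (index o l < t)%N.
Proof. by move=> ol; rewrite inE in_take. Qed.

Lemma step_nth e0 l t : uniq l -> (t < size l)%N ->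
  step l (nth e0 l t) = gain (nth e0 l t) (prefix_set l t).
Proof. by move=> ul tl; rewrite /step index_uniq. Qed.

Lemma sum_step l t : uniq l -> (t <= size l)%N ->
  \sum_(e in prefix_set l t) step l e = f (prefix_set l t).
Proof.
move=> ul; elim: t => [|t IH] tl.
  by rewrite prefix_set0 big_set0 objective_set0.
have [e0 _] : exists e0, e0 \in l.
  by case: (l) tl => // e0 s; exists e0; rewrite mem_head.
have nin := nth_notin_prefix e0 ul tl.
rewrite (prefix_setS e0 tl) big_setU1 // (IH (ltnW tl)).
by rewrite (step_nth e0 ul tl) objectiveU1 addrC.
Qed.

(** The bound [c] is left free because the two ratios use different estimates of the examined gains;
    [v = size l] covers elements examined after the last acceptance. *)
Lemma optimum_le_trace gamma alpha l O (c : ground X -> R) :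
  0 < gamma -> dr_admissible X gamma -> curv_admissible X alpha ->
  uniq l -> feasible O ->
  (forall o, o \in O -> o \notin l ->
    exists2 v, (v <= size l)%N & gain o (prefix_set l v) <= c o) ->
  f O <= \sum_(e in [set x in l]) (if e \in O then 1 else alpha) * step l e +
         gamma^-1 * \sum_(o in O :\: [set x in l]) c o.
Proof.
move=> g0 dr cu ul feas exv.
have [v vP] : exists v : ground X -> nat, forall o, o \in O -> o \notin l ->
    (v o <= size l)%N /\ gain o (prefix_set l (v o)) <= c o.
  apply: (@fin_all_exists _ _ (fun o v => o \in O -> o \notin l ->
    (v <= size l)%N /\ gain o (prefix_set l v) <= c o)) => o.
  have [oO|oO] := boolP (o \in O); last by exists 0%N.
  have [ol|ol] := boolP (o \in l); first by exists 0%N.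
  by have [w] := exv o oO ol; exists w.
pose wt e : R := if e \in O then 1 else alpha.
pose N := O :\: [set x in l].
pose NN t := [set o in N | v o == t].
(* The elements of [O] still to be processed at prefix [t]: an accepted element leaves after its own
   position, any other after the prefix at which it was examined. *)
pose Q t := [set o in O | (t <= if o \in l then index o l else v o)%N].
have gi : 0 <= gamma^-1 by rewrite invr_ge0 ltW.
have batch t B : B \subset O -> f (prefix_set l t :|: B :|: NN t) <=
    f (prefix_set l t :|: B) + gamma^-1 * \sum_(o in N | v o == t) c o.
  move=> BO.
  have sNO : NN t \subset O.
    by apply/subsetP => o; rewrite !inE => /andP[/andP[]].
  apply: le_trans (objective_batch_le g0 dr _ _) _.
  - by apply: feasible_sub feas; rewrite subUset BO.
  - apply/pred0P => o /=; apply/negP => /andP[]; rewrite !inE.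
    by case/andP => /andP[/negP ol _] _ /mem_take.
  rewrite lerD2l; apply: ler_wpM2l => //.
  rewrite (eq_bigl (fun o => (o \in N) && (v o == t))); last first.
    by move=> o; rewrite [o \in NN t]inE.
  apply: ler_sum => o /andP[]; rewrite !inE => /andP[ol oO] /eqP <-.
  by have [] := vP o oO ol.
(* The prefix grows from the empty one, with all of [O] on top. By [sum_step], the weighted sum
   minus [f (prefix_set l t)] is -(1 - alpha) times the total step of the accepted elements outside
   [O], the amount recovered so far. *)
have claim t : (t <= size l)%N -> f O <= f (prefix_set l t :|: Q t) +
    \sum_(e in prefix_set l t) wt e * step l e - f (prefix_set l t) +
    gamma^-1 * \sum_(o in N | (v o < t)%N) c o.
  elim: t => [|t IH] tl.
    rewrite prefix_set0 set0U big_set0 big_pred0; last by move=> o; rewrite andbF.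
    by rewrite objective_set0 mulr0 !addr0 subr0; apply: objective_mono;
      apply/subsetP => o oO; rewrite inE oO.
  apply: le_trans (IH (ltnW tl)) _.
  have [e0 _] : exists e0, e0 \in l by case: (l) tl => // e0 s; exists e0; rewrite mem_head.
  pose e := nth e0 l t.
  have el : e \in l by exact: mem_nth.
  have ie : index e l = t by exact: index_uniq.
  have enp : e \notin prefix_set l t by exact: nth_notin_prefix.
  have QO : Q t.+1 \subset O by apply/subsetP => o; rewrite inE => /andP[].
  have sumS : \sum_(o in N | (v o < t.+1)%N) c o =
      \sum_(o in N | (v o < t)%N) c o + \sum_(o in N | v o == t) c o.
    rewrite (bigID (fun o => (v o < t)%N)) /=; congr (_ + _); apply: eq_bigl => o.
      by rewrite ltnS -andbA; congr (_ && _); case: ltnP => [/ltnW ->|]; rewrite ?andbF.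
    by rewrite -andbA -leqNgt ltnS -eqn_leq.
  rewrite (prefix_setS e0) // -/e big_setU1 //= sumS objectiveU1 [gamma^-1 * (_ + _)]mulrDr.
  have -> : step l e = gain e (prefix_set l t) by rewrite /step ie.
  have Qsplit : Q t = Q t.+1 :|: NN t :|: (if e \in O then [set e] else set0).
    apply/setP => o; rewrite !inE.
    have [->|oe] := eqVneq o e.
      by rewrite el ie leqnn ltnn /=; case: ifP => eO; rewrite ?inE ?eqxx ?eO.
    have -> : (o \in (if e \in O then [set e] else set0)) = false.
      by case: ifP; rewrite inE // (negbTE oe).
    case: (boolP (o \in O)) => oO /=; last by rewrite andbF.
    rewrite andbT orbF; case: (boolP (o \in l)) => ol /=.
      rewrite orbF leq_eqVlt; case: eqP => //= to.
      by case/eqP: oe; rewrite /e to nth_index.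
    by rewrite leq_eqVlt orbC eq_sym.
  suff : f (prefix_set l t :|: Q t) <=
      f (e |: prefix_set l t :|: Q t.+1) + (wt e - 1) * gain e (prefix_set l t) +
      gamma^-1 * \sum_(o in N | v o == t) c o by lra.
  (* If [e] is in [O], it merely passes from [Q t] to the prefix, and only the batch [NN t] has a
     cost. *)
  rewrite Qsplit /wt; case: ifP => eO.
    have -> : prefix_set l t :|: (Q t.+1 :|: NN t :|: [set e]) =
        prefix_set l t :|: (e |: Q t.+1) :|: NN t.
      by rewrite -!setUA; congr (_ :|: _); rewrite setUA setUC.
    rewrite subrr mul0r addr0 [e |: prefix_set l t]setUC -[_ :|: _ :|: Q _]setUA.
    by apply: batch; rewrite subUset sub1set eO.
  rewrite setU0 setUA; apply: le_trans (batch t _ QO) _; rewrite lerD2r.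
  (* For [e] outside [O], curvature applies because the increment [Q t.+1] is part of [O], hence
     feasible. *)
  have eQ : e \notin prefix_set l t :|: Q t.+1.
    by rewrite inE negb_or enp inE eO.
  rewrite -setUA objectiveU1; suff : (1 - alpha) * gain e (prefix_set l t) <=
    gain e (prefix_set l t :|: Q t.+1) by lra.
  apply: cu; split=> //; first exact: subsetUl.
  apply: feasible_sub feas; rewrite setDUl setDv set0U.
  by apply: subset_trans (subsetDl _ _) QO.
apply: le_trans (claim _ (leqnn _)) _.
(* Only elements examined at the full trace remain; they form one last batch, and the two values of
   [f] at the full trace cancel. *)
have := batch (size l) set0 (sub0set _); rewrite setU0 prefix_set_size.
have -> : Q (size l) = NN (size l).
  apply/setP => o; rewrite !inE; case: (boolP (o \in O)) => oO /=; last by rewrite andbF.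
  rewrite andbT; case: (boolP (o \in l)) => ol /=; first by rewrite leqNgt index_mem ol.
  by have [vo _] := vP o oO ol; rewrite eqn_leq vo.
have -> : \sum_(o in N) c o = \sum_(o in N | (v o < size l)%N) c o +
    \sum_(o in N | v o == size l) c o.
  rewrite (bigID (fun o => (v o < size l)%N)) /=; congr (_ + _); apply: eq_bigl => o.
  rewrite !inE; case: (boolP (o \in l)) => //= ol; case: (boolP (o \in O)) => //= oO.
  by have [vo _] := vP o oO ol; rewrite -leqNgt eqn_leq vo.
rewrite mulrDr /wt; lra.
Qed.
End Traces.

(** * The invariant of the algorithm *)
Section Invariant.
Variables (R : realType) (X : pm_instance R) (eps : R).
Hypothesis eps01 : 0 <= eps <= 1.
Implicit Types (e o : ground X) (l : seq (ground X)) (i : 'I_(nparts X)).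
Implicit Types (st : thr_state X) (p : 'I_(nparts X) * ground X).
Notation f := (@objective R X).

Definition rejected l (thr : R) o : Prop :=
  exists2 v, (v <= size l)%N & gain o (prefix_set l v) < thr.

(** The factor absorbs the drop of the threshold between scans: what is rejected at [tau] is almost
    rejected at [tau * (1 - eps)]. Kept as a product, it needs no division when [eps = 1]. *)
Definition almost_rejected l (thr : R) o : Prop :=
  exists2 v, (v <= size l)%N & (1 - eps) * gain o (prefix_set l v) <= thr.

Lemma prefix_set_rcons l e v : (v <= size l)%N ->
  prefix_set (rcons l e) v = prefix_set l v.
Proof. by move=> vl; rewrite /prefix_set -cats1 takel_cat. Qed.

Lemma rejected_rcons l e thr o : rejected l thr o -> rejected (rcons l e) thr o.
Proof.
by case=> v vl h; exists v; rewrite ?size_rcons ?leqW // prefix_set_rcons.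
Qed.

Lemma almost_rejected_rcons l e thr o :
  almost_rejected l thr o -> almost_rejected (rcons l e) thr o.
Proof.
by case=> v vl h; exists v; rewrite ?size_rcons ?leqW // prefix_set_rcons.
Qed.

Lemma almost_rejected_le l thr thr' o : thr <= thr' ->
  almost_rejected l thr o -> almost_rejected l thr' o.
Proof. by move=> le [v vl h]; exists v => //; apply: le_trans le. Qed.

(** [l] lists the solution in order of acceptance. [trace_pending] is maintained against the current
    threshold; an acceptance, whose gain reaches that threshold, freezes it into [trace_accepted].
    Both concern only parts that are not full, since elements of full parts are no longer
    examined. *)
Record trace_of st l : Prop := TraceOf {
  trace_uniq : uniq l;
  trace_sol : sol st = [set x in l];
  trace_active : forall i,
    (i \in active st) = (#|sol st :&: part i| < budget i)%N;
  trace_feasible : feasible (sol st);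
  trace_accepted : forall l1 e l2, l = l1 ++ e :: l2 ->
    forall o i, o \in part i -> o \notin l1 ->
      (#|[set x in l1] :&: part i| < budget i)%N ->
      almost_rejected l1 (gain e [set x in l1]) o;
  trace_pending : forall o i, i \in active st -> o \in part i -> o \notin l ->
    almost_rejected l (tau st) o }.

(** A strict bound at the undiminished threshold, valid within one scan; at the end of the scan it
    renews [trace_pending] for the lowered threshold. *)
Definition scanned st l (done : seq ('I_(nparts X) * ground X)) : Prop :=
  forall p, p \in done -> p.1 \in active st -> p.2 \in part p.1 ->
    p.2 \notin l -> rejected l (tau st) p.2.

Lemma tau_visit st p : tau (thr_visit st p) = tau st.
Proof. by case: p => i e /=; case: ifP => // _; case: ifP. Qed.

Lemma tau_scan st s : tau (foldl (@thr_visit R X) st s) = tau st.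
Proof. by elim: s st => //= p s IH st; rewrite IH tau_visit. Qed.

Lemma sol_visit st p : sol st \subset sol (thr_visit st p).
Proof. by case: p => i e /=; case: ifP => //= _; case: ifP => //=; rewrite subsetUr. Qed.

Lemma sol_scan st s : sol st \subset sol (foldl (@thr_visit R X) st s).
Proof.
elim: s st => //= p s IH st; exact: subset_trans (sol_visit st p) (IH _).
Qed.

(** After an acceptance, [f] of the solution is at least the accepted gain, because [f] is
    nonnegative, and that gain is at least [tau]. *)
Lemma sol_scan_ge st s : (sol st == set0) || (tau st <= f (sol st)) ->
  (sol (foldl (@thr_visit R X) st s) == set0) ||
  (tau st <= f (sol (foldl (@thr_visit R X) st s))).
Proof.
elim: s st => //= p s IH st h; rewrite -(tau_visit st p); apply: IH.
rewrite tau_visit; case: p => i e /=; case: ifP => //= _; case: ifP => //=.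
move=> h1; apply/orP; right; apply: le_trans h1 _.
by rewrite /gain lerBlDr lerDl objective_ge0.
Qed.

Lemma queries_scan st s :
  (queries (foldl (@thr_visit R X) st s) <= queries st + 2 * size s)%N.
Proof.
elim: s st => [|p s IH] st /=; first by rewrite addn0.
apply: leq_trans (IH _) _; rewrite mulnS addnA leq_add2r.
case: p => i e /=; case: ifP => _; last exact: leq_addr.
by case: ifP => _ /=.
Qed.

(** Appending to the trace keeps all earlier prefixes, so recorded examinations survive, and the
    active set only shrinks, so earlier pairs bring no new obligation. *)
Lemma visit_trace st l done p : trace_of st l -> scanned st l done ->
  exists2 l', trace_of (thr_visit st p) l' & scanned (thr_visit st p) l' (p :: done).
Proof.
move=> [ul sl al fl accl pendl] sc; case: p => i e.
have eps0 : 0 <= eps by case/andP: eps01.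
rewrite /thr_visit; case: ifP => [/andP[ia]|skip]; last first.
  exists l => // p; rewrite inE => /orP[/eqP ->|]; last exact: sc.
  by move=> /= ia ei enl; move: skip; rewrite ia in_setD ei sl inE (negbTE enl).
rewrite in_setD {1}sl inE => /andP[enl ei].
case: ifP => [acc|rej]; last first.
  exists l; first by apply: TraceOf => //=.
  move=> p; rewrite inE => /orP[/eqP ->|]; last exact: sc.
  move=> /= _ _ _; exists (size l) => //; rewrite prefix_set_size.
  by rewrite /= -sl ltNge rej.
set st' := ThrState _ _ _ _.
have sl' : sol st' = [set x in rcons l e].
  by apply/setP => x; rewrite /= sl !inE mem_rcons inE.
have cardE j : #|sol st' :&: part j| = ((j == i) + #|sol st :&: part j|)%N.
  rewrite /st' /= setIUl; have [->|ji] := eqVneq j i.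
    rewrite (setIidPl _) ?sub1set // cardsU1 in_setI sl inE.
    by rewrite (negbTE enl).
  have ej : e \in part j = false.
    by rewrite (disjointFr (part_disjoint _) ei) // eq_sym.
  by rewrite (_ : [set e] :&: _ = set0) ?set0U //; apply/setP => x;
    rewrite !inE; case: eqP => // ->; rewrite ej.
have al' j : (j \in active st') = (#|sol st' :&: part j| < budget j)%N.
  rewrite cardE; have [->|ji] := eqVneq j i.
    rewrite add1n /st' /=; move: (cardE i); rewrite eqxx add1n /= => ->.
    by case: leqP => _; rewrite ?in_setD1 ?eqxx ?ia.
  by rewrite add0n -al /st' /=; case: ifP => // _; rewrite in_setD1 ji.
have act' j : j \in active st' -> j \in active st.
  by rewrite /st' /=; case: ifP => // _ /setD1P[].
exists (rcons l e).
- split => //.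
  + by rewrite rcons_uniq enl.
  + move=> j; rewrite cardE; have [->|ji] := eqVneq j i.
      by rewrite add1n -al.
    exact: fl.
  (* If [e'] is the new element, the pending bound at [tau] passes to its gain, which is at least
     [tau]. *)
  + move=> l1 e' l2; case/lastP: l2 => [|l2 x].
      rewrite cats1 => /rcons_inj[<- <-] o j oj onl cj.
      apply: (@almost_rejected_le _ (tau st)); first by rewrite -sl.
      by apply: pendl oj onl; rewrite al sl.
    rewrite -rcons_cons -rcons_cat => /rcons_inj[ll _]; exact: accl ll.
  + move=> o j /act' ja oj; rewrite mem_rcons inE negb_or => /andP[_ onl].
    by apply: almost_rejected_rcons; apply: pendl oj onl.
- move=> p; rewrite inE => /orP[/eqP ->|pd]; first by rewrite mem_rcons mem_head.
  move=> /act' pa pp; rewrite mem_rcons inE negb_or => /andP[_ pnl].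
  by apply: rejected_rcons; apply: sc.
Qed.

Lemma scan_trace st l s : trace_of st l ->
  exists2 l', trace_of (foldl (@thr_visit R X) st s) l' &
    scanned (foldl (@thr_visit R X) st s) l' s.
Proof.
move=> tl.
suff [l' tl' sc] : exists2 l', trace_of (foldl (@thr_visit R X) st s) l' &
    scanned (foldl (@thr_visit R X) st s) l' (catrev s [::]).
  exists l' => // p ps; apply: sc; by rewrite -[catrev _ _]/(rev s) mem_rev.
have : scanned st l [::] by [].
elim: s st l [::] tl => [|p s IH] st l done tl sc /=; first by exists l.
have [l' tl' sc'] := visit_trace p tl sc; exact: IH tl' sc'.
Qed.

Variable ord : nat -> seq ('I_(nparts X) * ground X).
Hypothesis ordP : scan_orders ord.

Lemma mem_ord r i e : ((i, e) \in ord r) = (e \in part i).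
Proof. by rewrite (perm_mem (ordP r)) mem_enum. Qed.

Lemma size_ord r : (size (ord r) <= #|ground X|)%N.
Proof.
rewrite (perm_size (ordP r)) -cardE.
apply: (@leq_card_in _ _ snd) => -[i e] [j e'] /= ; rewrite !inE /= => ei ej ee'.
rewrite -{}ee' in ej *; congr (_, _); apply/eqP; apply: contraLR ej => ij.
by rewrite (disjointFr (part_disjoint ij) ei).
Qed.

Lemma gain_le_tau0 e : gain e set0 <= tau0 X.
Proof. exact: (le_bigmax 0 (fun e => gain e set0)). Qed.

Lemma tau0_ge0 : 0 <= tau0 X.
Proof. by rewrite /tau0; apply: bigmax_ge_id. Qed.

Lemma init_trace : trace_of (thr_init X) [::].
Proof.
have eps0 : 0 <= eps by case/andP: eps01.
split => //=.
- by move=> i; rewrite inE set0I cards0; have /andP[->] := budget_bounds i.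
- by move=> i; rewrite set0I cards0.
- by case.
- move=> o i _ _ _; exists 0%N => //; rewrite prefix_set0.
  apply: le_trans (gain_le_tau0 o).
  by rewrite ler_piMl ?gain_ge0 // gerBl.
Qed.

Lemma round_trace st l r : trace_of st l ->
  exists l', trace_of (thr_round eps (ord r) st) l'.
Proof.
have [eps0 eps1] := andP eps01.
move=> /(scan_trace (ord r))[l' tl sc]; exists l'; case: tl => ul sl al fl accl pendl.
split=> // o i ia oi onl; rewrite /thr_round /=.
have [v vl h] := sc (i, o) (etrans (mem_ord r i o) oi) ia oi onl.
by exists v => //; rewrite mulrC ler_wpM2r ?subr_ge0 // ltW.
Qed.

Lemma run_trace r : exists l, trace_of (thr_run eps ord r) l.
Proof.
elim: r => [|r [l IH]] /=; first by exists [::]; exact: init_trace.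
by case: ifP => _; [exact: round_trace IH|exists l].
Qed.

(** Gains are nonnegative, so nothing is rejected: a part still active would be wholly selected, yet
    its budget is at most its size. This gives termination when the threshold test never fails. *)
Lemma round_nonpos_tau st l r : trace_of st l -> tau st <= 0 ->
  active (thr_round eps (ord r) st) = set0.
Proof.
move=> /(scan_trace (ord r))[l' [ul sl al fl accl pendl] sc] t0.
apply/eqP; rewrite -subset0; apply/subsetP => i /= ia.
have : part i \subset sol (foldl (@thr_visit R X) st (ord r)).
  apply/subsetP => e ei; rewrite sl inE; apply/negPn/negP => enl.
  have [v _] := sc (i, e) (etrans (mem_ord r i e) ei) ia ei enl.
  rewrite tau_scan => /lt_le_trans/(_ t0).
  by rewrite ltNge gain_ge0.
move=> /setIidPr pE; move: ia; rewrite al pE.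
by have /andP[_] := budget_bounds i; rewrite ltnNge => ->.
Qed.

Lemma tau0_attained : exists e, gain e set0 = tau0 X.
Proof.
have [e0 _] : exists e0, e0 \in part (Ordinal (nparts_gt0 X)).
  by apply/set0Pn; exact: part_nonempty.
have [e _ he] := @eq_bigmax _ _ _ 0 e0 xpredT (fun e => gain e set0) isT
  (fun e _ => gain_ge0 e set0).
by exists e; rewrite /tau0 he.
Qed.

(** If the first scan accepted nothing, an element attaining [tau0] would have been rejected at the
    empty set. The bound lets the slack eps tau0 be charged to the output. *)
Lemma first_round_ge : tau0 X <= f (sol (thr_round eps (ord 0) (thr_init X))).
Proof.
have := @sol_scan_ge (thr_init X) (ord 0); rewrite eqxx => /(_ isT)/orP[/eqP s0|//].
have [l' [ul sl al fl accl pendl] sc] := scan_trace (ord 0) init_trace.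
have [e ge] := tau0_attained; have [i ei] := part_cover e.
have l0 : l' = [::].
  case: l' sl {ul al fl accl pendl sc} => // x l' sl.
  by move: s0; rewrite sl => /setP/(_ x); rewrite !inE eqxx.
have [||v _] := sc (i, e) (etrans (mem_ord 0 i e) ei) _ ei.
- by rewrite al s0 set0I cards0; have /andP[->] := budget_bounds i.
- by rewrite l0.
- rewrite l0 tau_scan (_ : prefix_set _ _ = set0); last by apply/setP => x; rewrite !inE.
  by rewrite ge ltxx.
Qed.

End Invariant.

(** * Approximation *)
Section Budgets.
Variables (R : realType) (X : pm_instance R).

Lemma min_budget_le (i : 'I_(nparts X)) : (min_budget X <= budget i)%N.
Proof.
rewrite /min_budget; have := mem_index_enum i.
elim: (index_enum _) => // j s IH; rewrite inE big_cons => /orP[/eqP <-|/IH h].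
  exact: geq_minl.
by rewrite (leq_trans _ h) // geq_minr.
Qed.

Lemma total_budget_gt0 : (0 < total_budget X)%N.
Proof.
have i0 := Ordinal (nparts_gt0 X).
rewrite /total_budget (bigD1 i0) //= addn_gt0.
by have /andP[->] := budget_bounds i0.
Qed.

Lemma min_budget_gt0 : (0 < min_budget X)%N.
Proof.
rewrite /min_budget; elim/big_ind: _ => [|x y x0 y0|i _]; first exact: total_budget_gt0.
  by rewrite leq_min x0.
by have /andP[->] := budget_bounds i.
Qed.

Lemma min_budget_total : (min_budget X <= total_budget X)%N.
Proof.
rewrite /min_budget; elim/big_rec: _ => // i x _ h.
by apply: leq_trans h; exact: geq_minr.
Qed.

Lemma ratio2E gamma alpha eps : ratio2 X gamma alpha eps =
  greedy_ratio (gamma * (1 - eps)) alpha (total_budget X) (min_budget X).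
Proof.
rewrite /ratio2; case: eqVneq => [->|a0].
  rewrite /greedy_ratio !mul0r subr0 mulrAC; congr (_ * _).
  by under eq_bigr do rewrite expr1n; rewrite sumr_const card_ord.
by apply: (mulfI a0); rewrite mul_greedy_ratio mulVKf // !mulrA.
Qed.
End Budgets.

Section Approximation.
Variables (R : realType) (X : pm_instance R) (gamma alpha eps : R).
Hypotheses (gamma0 : 0 < gamma) (gamma1 : gamma <= 1).
Hypothesis alpha01 : 0 <= alpha <= 1.
Hypotheses (eps0 : 0 <= eps) (eps1 : eps < 1).
Hypothesis dr : dr_admissible X gamma.
Hypothesis cu : curv_admissible X alpha.
Variables (st : thr_state X) (l : seq (ground X)) (O : {set ground X}).
Hypothesis tr : trace_of eps st l.
Hypothesis stop : ~~ thr_guard eps st.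
Hypothesis first : tau0 X <= objective (sol st).
Hypothesis feas : feasible O.
Implicit Types (e o : ground X).
Notation f := (@objective R X).
Let b : R := (total_budget X)%:R.
Let q := 1 - eps.
Let S : {set ground X} := [set x in l].

Let q0 : 0 < q. Proof. by rewrite subr_gt0. Qed.
Let b0 : 0 < b. Proof. by rewrite ltr0n total_budget_gt0. Qed.
Let ul : uniq l. Proof. exact: trace_uniq tr. Qed.
Let solE : sol st = S. Proof. exact: trace_sol tr. Qed.
Let step0 l' e : 0 <= step l' e. Proof. exact: gain_ge0. Qed.

Lemma step_take e t : e \in take t l -> step (take t l) e = step l e.
Proof.
move=> et; have il : index e (take t l) = index e l.
  by rewrite -{2}(cat_take_drop t l) index_cat et.
have it : (index e l <= t)%N.
  by rewrite -il (leq_trans (index_size _ _)) // size_take_min geq_minl.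
by rewrite /step /prefix_set il take_takel.
Qed.

Lemma almost_rejected_take t o (thr : R) :
  almost_rejected eps (take t l) thr o -> almost_rejected eps l thr o.
Proof.
case=> v; rewrite size_take_min leq_min => /andP[vt vl] h; exists v => //.
by move: h; rewrite /prefix_set take_takel.
Qed.

Lemma big_prefix_set (T : Type) (idx : T) (op : Monoid.com_law idx) e0 t
    (F : ground X -> T) : (t <= size l)%N ->
  \big[op/idx]_(e in prefix_set l t) F e = \big[op/idx]_(u < t) F (nth e0 l u).
Proof.
move=> tl; rewrite (eq_bigl (mem (take t l))); last by move=> e; rewrite inE.
rewrite -big_uniq ?take_uniq //= (big_nth e0) size_takel // big_mkord.
by apply: eq_bigr => i _; rewrite nth_take.
Qed.

Lemma accepted_examined t e0 o i : (t < size l)%N -> o \in part i ->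
  o \notin take t l -> (#|prefix_set l t :&: part i| < budget i)%N ->
  almost_rejected eps (take t l) (step l (nth e0 l t)) o.
Proof.
move=> tl oi ot ct; rewrite (step_nth e0 ul tl).
by apply: (trace_accepted tr (l2 := drop t.+1 l)) oi ot ct;
  rewrite -(drop_nth e0) // cat_take_drop.
Qed.

(** An unfilled part is still active, so the loop stopped because [tau] fell below its limit; the
    factor 1 - eps in that limit cancels the one in [trace_pending]. *)
Lemma unfilled_examined o i : o \in part i -> o \notin l ->
  (#|S :&: part i| < budget i)%N ->
  exists2 v, (v <= size l)%N & gain o (prefix_set l v) <= eps * tau0 X / b.
Proof.
move=> oi ol; rewrite -solE -(trace_active tr) => ia.
have [v vl h] := trace_pending tr ia oi ol; exists v => //.
have : tau st <= q * (eps * tau0 X / b).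
  move: stop; rewrite /thr_guard negb_and negbK => /orP[/eqP a0|].
    by rewrite a0 inE in ia.
  by rewrite -ltNge => /ltW; rewrite /b /q !mulrA [eps * _]mulrC.
by move=> /(le_trans h); rewrite ler_pM2l.
Qed.

Lemma sum_slack_le : \sum_(o in O :\: S) (eps * tau0 X / b) <= eps * tau0 X.
Proof.
have cO : #|O :\: S|%:R <= b.
  rewrite ler_nat (leq_trans _ (feasible_card feas)) //.
  by rewrite subset_leq_card // subsetDl.
rewrite sumr_const -[_ *+ _]mulr_natr.
apply: le_trans (ler_wpM2l _ cO) _; last by rewrite divfK // gt_eqF.
by rewrite divr_ge0 ?mulr_ge0 ?tau0_ge0 // ltW.
Qed.

(** Take for [m] the least step among the accepted elements of part [j] outside [O]. When the
    minimizer was accepted, every [o] of part [j] missing from [l] was available. *)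
Lemma part_threshold (pt : ground X -> 'I_(nparts X)) j :
  (forall e i, (e \in part i) = (pt e == i)) -> exists m : R,
  [/\ 0 <= m, forall e, e \in S :\: O -> pt e = j -> m <= step l e
    & (budget j <= #|S :&: part j|)%N ->
      forall o, o \in O -> o \notin l -> pt o = j -> almost_rejected eps l m o].
Proof.
move=> ptP; case: (pickP [pred e | (e \in S :\: O) && (pt e == j)]) => [e0 /= he0|none].
  have [e /andP[eSO ej] emin] := @arg_minP _ _ _ e0
    [pred e | (e \in S :\: O) && (pt e == j)] (step l) he0.
  exists (step l e); split=> // [e' e'SO /eqP e'j|filled o oO ol oj].
    by apply: emin; rewrite /= e'SO e'j.
  have el : e \in l by move: eSO; rewrite !inE => /andP[].
  have := @accepted_examined (index e l) e o j; rewrite index_mem nth_index // => h.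
  apply: almost_rejected_take (h el _ _ _).
  - by rewrite ptP oj.
  - by apply: contra ol; exact: mem_take.
  (* There was room in part [j] before [e]: the final solution respects the budget and contains [e]
     besides the prefix. *)
  - apply: leq_trans (trace_feasible tr j); rewrite solE.
    apply: proper_card; apply/properP; split; first by rewrite setSI // prefix_set_sub.
    exists e; rewrite in_setI ptP ej andbT; first by rewrite inE.
    by rewrite mem_prefix_set // ltnn.
(* With no accepted element of part [j] outside [O], a full part leaves no such [o]: it would push
   [O] over the budget. *)
exists 0; split=> // filled o oO ol oj.
suff : (#|S :&: part j| < #|O :&: part j|)%N.
  by move=> /(leq_ltn_trans filled); rewrite ltnNge feas.
apply: proper_card; apply/properP; split.
  apply/subsetP => e; rewrite !in_setI => /andP[eS ej]; rewrite ej andbT.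
  by have := none e; rewrite /= in_setD eS -ptP ej !andbT => /negbFE.
by exists o; rewrite !in_setI ?oO ptP oj eqxx // inE (negbTE ol).
Qed.

(** The three coefficients come from the accepted elements outside [O], the replacements in full
    parts, and the slack in unfilled parts. *)
Lemma optimum_le_all_parts :
  f O <= (alpha + gamma^-1 * q^-1 + gamma^-1 * eps) * f (sol st).
Proof.
have [pt ptP] := part_index_exists X.
have [m mP] := fin_all_exists (fun j => part_threshold j ptP).
pose c o := if (#|S :&: part (pt o)| < budget (pt o))%N
            then eps * tau0 X / b else m (pt o) / q.
have beta0 : 0 <= eps * tau0 X / b.
  by rewrite divr_ge0 ?mulr_ge0 ?tau0_ge0 // ltW.
apply: le_trans
  (@optimum_le_trace _ X gamma alpha l O c gamma0 dr cu ul feas _) _ => [o oO ol|].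
  rewrite /c; case: ltnP => [unf|fil].
    by apply: unfilled_examined ol unf; rewrite ptP.
  have [_ _ h] := mP (pt o); have [v vl hv] := h fil o oO ol erefl.
  by exists v => //; rewrite ler_pdivlMr // mulrC.
have sumc : \sum_(o in O :\: S) c o <=
    q^-1 * (\sum_(e in S :\: O) step l e) + eps * tau0 X.
  apply: le_trans (_ : _ <= q^-1 * (\sum_(e in S :\: O) step l e) +
      \sum_(o in O :\: S) (eps * tau0 X / b)) _; last first.
    by rewrite lerD2l sum_slack_le.
  rewrite !(partition_big pt predT) //= mulr_sumr -big_split /=.
  apply: ler_sum => j _; have [m0 mle _] := mP j.
  have [unf|fil] := ltnP #|S :&: part j| (budget j).
    rewrite (eq_bigr (fun=> eps * tau0 X / b)); last first.
      by move=> o /andP[_ /eqP oj]; rewrite /c oj unf.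
    by rewrite lerDr mulr_ge0 ?invr_ge0 ?(ltW q0) // sumr_ge0.
  rewrite (eq_bigr (fun=> m j / q)); last first.
    by move=> o /andP[_ /eqP oj]; rewrite /c oj ltnNge fil.
  apply: le_trans (_ : _ <= q^-1 * \sum_(e in S :\: O | pt e == j) step l e) _;
    last by rewrite lerDl sumr_ge0.
  rewrite -mulr_suml mulrC; apply: ler_wpM2l; first by rewrite invr_ge0 ltW.
  apply: le_trans (_ : _ <= \sum_(e in S :\: O | pt e == j) m j) _; last first.
    by apply: ler_sum => e /andP[eSO /eqP ej]; exact: mle.
  rewrite !sumr_const; apply: ler_wpMn2l => //.
  have cj A B : #|[pred e | (e \in A :\: B) && (pt e == j)]| =
      #|(A :&: part j) :\: B|.
    by apply: eq_card => e; rewrite !inE ptP andbA.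
  rewrite !cj.
  (* In a full part [O] has at most as many elements as [S]; removing the common ones preserves
     this. *)
  have h1 := cardsID S (O :&: part j); have h2 := cardsID O (S :&: part j).
  have h3 := feas j.
  have h4 : #|O :&: part j :&: S| = #|S :&: part j :&: O|.
    by rewrite -setIA setIC [part j :&: S]setIC.
  by rewrite -(leq_add2l #|O :&: part j :&: S|) h1 h4 h2 (leq_trans h3).
move: sumc; rewrite solE -/S => sumc.
have fS : f S = \sum_(e in S :&: O) step l e + \sum_(e in S :\: O) step l e.
  by rewrite /S -prefix_set_size -(sum_step ul (leqnn _)) prefix_set_size -big_setID.
have -> : \sum_(e in [set x in l]) (if e \in O then 1 else alpha) * step l e =
    \sum_(e in S :&: O) step l e + alpha * \sum_(e in S :\: O) step l e.
  rewrite (big_setID O) mulr_sumr; congr (_ + _); apply: eq_bigr => e.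
    by rewrite inE => /andP[_ ->]; rewrite mul1r.
  by rewrite inE => /andP[/negbTE ->].
have : tau0 X <= f S by rewrite -solE.
have T1 : 0 <= \sum_(e in S :&: O) step l e by apply: sumr_ge0.
have T2 : 0 <= \sum_(e in S :\: O) step l e by apply: sumr_ge0.
move: T1 T2 fS sumc; set T1 := \sum_(e in S :&: O) _.
set T2 := \sum_(e in S :\: O) _ => T10 T20 fS sumc t0.
have gi : 1 <= gamma^-1 by rewrite invf_ge1.
have qi : 1 <= q^-1 by rewrite invf_ge1 ?gerBl.
have gi0 : 0 <= gamma^-1 by lra.
have h1 : gamma^-1 * (\sum_(o in O :\: S) c o) <=
  gamma^-1 * (q^-1 * T2 + eps * tau0 X) by exact: ler_wpM2l.
have h2 : gamma^-1 * eps * tau0 X <= gamma^-1 * eps * f S.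
  by apply: ler_wpM2l => //; exact: mulr_ge0.
(* The coefficient of [T1] is raised to that of [T2] so that both add up to [f S]. *)
have h3 : 1 * T1 <= gamma^-1 * q^-1 * T1.
  by apply: ler_wpM2r => //; rewrite -[1]mulr1 ler_pM.
have h4 : 0 <= alpha * T1 by apply: mulr_ge0 => //; case/andP: alpha01.
apply: le_trans (_ : _ <= T1 + alpha * T2 + gamma^-1 * (q^-1 * T2 + eps * tau0 X)) _.
  by rewrite lerD2l.
move: h2 h3; rewrite fS; set gq := gamma^-1 * q^-1; set ge := gamma^-1 * eps => h2 h3.
rewrite mulrDr !mulrA -/gq -/ge; lra.
Qed.

Lemma optimum_le_greedy :
  greedy_ratio (gamma * q) alpha (total_budget X) (min_budget X) * f O <=
  f (sol st).
Proof.
have kappa01 : 0 <= gamma * q <= 1.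
  rewrite mulr_ge0 ?(ltW gamma0) ?(ltW q0) //= mulr_ile1 ?(ltW gamma0) ?(ltW q0) //.
  by rewrite gerBl.
have [pt ptP] := part_index_exists X.
have [al0 al1] := andP alpha01.
(* With fewer than [min_budget] acceptances no part is full, so [O] exceeds [S] by at most eps tau0
   / gamma. The ratio is at most gamma q, and q (1 + eps) = 1 - eps^2 <= 1 concludes. *)
have [lsmall|llarge] := ltnP (size l) (min_budget X).
  have F0 : 0 <= f O by exact: objective_ge0.
  apply: le_trans (_ : _ <= gamma * q * f O) _.
    apply: ler_wpM2r => //; apply: le_trans (greedy_ratio_le kappa01 alpha01 _ _) _.
    rewrite ler_pdivrMr // ler_wpM2l ?ler_nat ?min_budget_total //.
    by case/andP: kappa01.
  have bound : f O <= f S + gamma^-1 * (eps * tau0 X).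
    apply: le_trans (@optimum_le_trace _ X gamma alpha l O
      (fun=> eps * tau0 X / b) gamma0 dr cu ul feas _) _.
      move=> o oO ol; apply: (unfilled_examined (i := pt o)) ol _; first by rewrite ptP.
      apply: leq_trans (min_budget_le (pt o)); apply: leq_ltn_trans lsmall.
      apply: leq_trans (subset_leq_card (subsetIl _ _)) _.
      by rewrite cardsE card_size.
    apply: lerD.
      rewrite /S -prefix_set_size -(sum_step ul (leqnn _)) prefix_set_size.
      by apply: ler_sum => e _; rewrite ler_piMl //; case: ifP.
    by apply: ler_wpM2l sum_slack_le; rewrite invr_ge0 ltW.
  have t0 : tau0 X <= f S by rewrite -solE.
  have T0 := tau0_ge0 X; rewrite solE.
  have kp : 0 <= gamma * q by case/andP: kappa01.
  apply: le_trans (ler_wpM2l kp bound) _.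
  have -> : gamma * q * (f S + gamma^-1 * (eps * tau0 X)) =
      gamma * q * f S + q * eps * tau0 X by field; rewrite gt_eqF.
  have h1 : q * eps * tau0 X <= q * eps * f S.
    by apply: ler_wpM2l => //; rewrite mulr_ge0 // ltW.
  have h2 : gamma * q * f S <= q * f S.
    by apply: ler_wpM2r; [exact: objective_ge0|rewrite ler_piMl // ltW].
  have h3 : (q + q * eps) * f S <= 1 * f S.
    by apply: ler_wpM2r; [exact: objective_ge0|rewrite /q; nra].
  lra.
have [e0 _] : exists e0, e0 \in l.
  by case: (l) (leq_trans (min_budget_gt0 X) llarge) => // e0 s; exists e0; rewrite mem_head.
pose a t := step l (nth e0 l t); pose hit t := nth e0 l t \in O.
apply: le_trans (_ : _ <= \sum_(u < min_budget X) a u) _; last first.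
  rewrite -(big_prefix_set _ e0 (step l) llarge) sum_step // solE.
  exact/objective_mono/prefix_set_sub.
apply: (@greedy_growth _ (gamma * q) alpha kappa01 alpha01 _ _ _ a hit) => //.
- exact: min_budget_total.
- exact: mulr_gt0.
- by move=> t; exact: step0.
move=> t tM; have tl : (t < size l)%N by exact: leq_trans llarge.
(* A prefix of length [t] below [min_budget] fills no part, so every element of [O] outside it was
   examined with gain at most [a t / q]. *)
have bound : f O <= \sum_(u < t) (if hit u then 1 else alpha) * a u +
    gamma^-1 * \sum_(o in O :\: prefix_set l t) (a t / q).
  apply: le_trans (@optimum_le_trace _ X gamma alpha (take t l) O
      (fun=> a t / q) gamma0 dr cu (take_uniq _ ul) feas _) _.
    move=> o oO ot; have := @accepted_examined t e0 o (pt o) tl.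
    rewrite ptP eqxx => /(_ isT ot)[].
      apply: leq_trans (min_budget_le (pt o)); apply: leq_ltn_trans tM.
      apply: leq_trans (subset_leq_card (subsetIl _ _)) _.
      by rewrite cardsE (leq_trans (card_size _)) // size_take_min geq_minl.
    by move=> v vl hv; exists v => //; rewrite ler_pdivlMr // mulrC.
  rewrite -/(prefix_set l t) lerD2r.
  rewrite -(big_prefix_set _ e0 (fun e => (if e \in O then 1 else alpha) * step l e) (ltnW tl)).
  by apply: ler_sum => e; rewrite inE => et; rewrite step_take.
have cO : (#|O :\: prefix_set l t| <= total_budget X - \sum_(u < t) hit u)%N.
  rewrite -(big_prefix_set _ e0 (fun e => (e \in O) : nat) (ltnW tl)).
  rewrite -big_mkcondr sum1_card.
  have -> : #|[pred e in prefix_set l t | e \in O]| = #|O :&: prefix_set l t|.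
    by apply: eq_card => e; rewrite !inE andbC.
  have := feasible_card feas; rewrite -(cardsID (prefix_set l t) O) => h.
  by rewrite leq_subRL // (leq_trans (leq_addr _ _) h).
have at0 : 0 <= a t by exact: step0.
move: bound; rewrite sumr_const -[_ *+ _]mulr_natr -lerBlDl => bound.
have kp : 0 <= gamma * q by case/andP: kappa01.
apply: le_trans (ler_wpM2l kp bound) _.
have -> : gamma * q * (gamma^-1 * (a t / q * #|O :\: prefix_set l t|%:R)) =
    #|O :\: prefix_set l t|%:R * a t.
  by field; rewrite !gt_eqF.
by apply: ler_wpM2r => //; rewrite ler_nat.
Qed.
End Approximation.

(** * Rounds and queries *)
Section Runs.
Variables (R : realType) (X : pm_instance R) (eps : R).
Hypothesis eps01 : 0 <= eps <= 1.
Variable ord : nat -> seq ('I_(nparts X) * ground X).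
Hypothesis ordP : scan_orders ord.
Notation run := (thr_run eps ord).
Notation b := ((total_budget X)%:R : R).

Let b1 : 1 <= b. Proof. by rewrite ler1n total_budget_gt0. Qed.

Lemma guard_init : thr_guard eps (thr_init X).
Proof.
have [eps0 eps1] := andP eps01.
apply/andP; split.
  by apply/set0Pn; exists (Ordinal (nparts_gt0 X)); rewrite inE.
rewrite /= ler_pdivrMr; last by rewrite (lt_le_trans ltr01).
rewrite mulrC; apply: ler_wpM2l; first exact: tau0_ge0.
by apply: le_trans b1; rewrite mulr_ile1 ?subr_ge0 // gerBl.
Qed.

Lemma sol_run_ge r : tau0 X <= objective (sol (run r.+1)).
Proof.
elim: r => [|r IH]; first by rewrite /= guard_init; exact: first_round_ge.
rewrite [run _]/=; case: ifP => // _; apply: le_trans IH _.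
exact/objective_mono/sol_scan.
Qed.

Lemma returned_sol_ge st : thr_returns eps ord st -> tau0 X <= objective (sol st).
Proof.
case=> -[|r] <-; last by move=> _; exact: sol_run_ge.
by rewrite guard_init.
Qed.

Lemma run_stopped r d : ~~ thr_guard eps (run r) -> run (d + r) = run r.
Proof. by move=> /negbTE stop; elim: d => //= d ->; rewrite stop. Qed.

Lemma guard_run_le r s : (r <= s)%N -> thr_guard eps (run s) -> thr_guard eps (run r).
Proof.
move=> rs; apply: contraTT => stop.
by rewrite -(subnK rs) run_stopped.
Qed.

Lemma tau_run r : thr_guard eps (run r) -> tau (run r) = tau0 X * (1 - eps) ^+ r.
Proof.
elim: r => [|r IH] g; first by rewrite expr0 mulr1.
have gr := guard_run_le (leqnSn r) g.
by rewrite /= gr /thr_round /= tau_scan (IH gr) exprSr mulrA.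
Qed.

Lemma queries_run r : (queries (run r) <= 2 * #|ground X| * r.+1)%N.
Proof.
elim: r => [|r IH]; first by rewrite muln1.
rewrite [run _]/=; case: ifP => _; last by rewrite (leq_trans IH) // leq_mul2l leqnSn orbT.
apply: leq_trans (queries_scan _ _) _; rewrite mulnS addnC leq_add //.
by rewrite leq_mul2l size_ord.
Qed.

(** Were the guard still true, cancelling tau0 (1 - eps) would give eps / b <= (1 - eps)^(N + 1) <=
    exp(- eps (N + 1)). *)
Lemma run_stops N : 0 < eps -> ln (b / eps) < eps * N.+1%:R ->
  ~~ thr_guard eps (run N.+2).
Proof.
move=> e0 lnN; have [_ eps1] := andP eps01.
apply/negP => g; have b0 : 0 < b by rewrite (lt_le_trans ltr01).
have t0 := tau0_ge0 X; have q0 : 0 <= 1 - eps by rewrite subr_ge0.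
(* If [eps = 1] or [tau0] vanishes, the guard's limit is 0 and nothing can be cancelled; but the
   threshold is 0 after one round, so the second empties the active set. *)
have [z|nz] := eqVneq (tau0 X * (1 - eps)) 0.
  have g1 := guard_run_le (isT : (1 <= N.+2)%N) g.
  have g2 := guard_run_le (isT : (2 <= N.+2)%N) g.
  have [l tl] := run_trace eps01 ordP 1.
  have t1 : tau (run 1) <= 0 by rewrite (tau_run g1) expr1 z.
  have a0 := @round_nonpos_tau _ _ _ eps01 _ ordP _ _ 1 tl t1.
  move: g2; rewrite -[run 2]/(if thr_guard eps (run 1)
    then thr_round eps (ord 1) (run 1) else run 1) g1 => /andP[].
  by rewrite a0 eqxx.
have pos : 0 < tau0 X * (1 - eps) by rewrite lt_def nz mulr_ge0.
have := g => /andP[_]; rewrite (tau_run g) exprS.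
have -> : eps * (1 - eps) * tau0 X / b = tau0 X * (1 - eps) * (eps / b) by ring.
rewrite [tau0 X * (_ * _)]mulrA ler_pM2l // => h.
have : eps / b <= expR (- (eps * N.+1%:R)).
  apply: le_trans h _; rewrite -mulNr expRM_natr.
  by apply: lerXn2r; rewrite ?nnegrE ?expR_ge0 // expR_ge1Dx.
rewrite -[eps / b]lnK; last by rewrite posrE divr_gt0.
rewrite ler_expR -[eps / b]invrK invf_div lnV ?posrE ?divr_gt0 // lerN2.
by rewrite leNgt lnN.
Qed.

Lemma queries_returned_le st : 0 < eps -> thr_returns eps ord st ->
  (queries st)%:R <= 2 * #|ground X|%:R * (3 + ln (b / eps) / eps).
Proof.
move=> e0 [r <- stop]; have [_ eps1] := andP eps01.
have ln0 : 0 <= ln (b / eps) / eps.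
  rewrite divr_ge0 ?(ltW e0) // ln_ge0 // ler_pdivlMr // mul1r.
  exact: le_trans eps1 b1.
pose N := Num.truncn (ln (b / eps) / eps).
have stopN : ~~ thr_guard eps (run N.+2).
  apply: run_stops => //; rewrite [eps * _]mulrC -ltr_pdivrMr //; exact: truncnS_gt.
have qN : (queries (run r) <= 2 * #|ground X| * N.+3)%N.
  have [rN|Nr] := leqP r N.+2.
    by apply: leq_trans (queries_run r) _; rewrite leq_mul2l ltnS rN orbT.
  by rewrite -(subnK (ltnW Nr)) run_stopped // queries_run.
apply: le_trans (_ : _ <= (2 * #|ground X| * N.+3)%:R) _; first by rewrite ler_nat.
rewrite !natrM; apply: ler_wpM2l; first by rewrite mulr_ge0 ?ler0n.
have : N%:R <= ln (b / eps) / eps by rewrite truncn_le.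
rewrite -addn3 natrD; lra.
Qed.

Lemma run_terminates : 0 < eps -> exists st, thr_returns eps ord st.
Proof.
move=> e0; pose N := Num.truncn (ln (b / eps) / eps).
exists (run N.+2), N.+2 => //; apply: run_stops => //.
rewrite [eps * _]mulrC -ltr_pdivrMr //; exact: truncnS_gt.
Qed.

End Runs.

(** * The stated ratios and the asymptotic query bounds *)

Lemma ratio1_le (R : realType) (gamma alpha eps : R) : 0 < gamma -> 0 <= eps < 1 ->
  0 <= alpha ->
  alpha + gamma^-1 * (1 - eps)^-1 + gamma^-1 * eps <= (ratio1 gamma alpha eps)^-1.
Proof.
move=> g0 /andP[e0 e1] a0; rewrite /ratio1 invf_div.
set q := 1 - eps; have q0 : 0 < q by rewrite subr_gt0.
have -> : eps = 1 - q by rewrite /q; ring.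
rewrite ler_pdivlMr; last by rewrite mulr_gt0 // exprn_gt0.
have -> : (alpha + gamma^-1 / q + gamma^-1 * (1 - q)) * (gamma * q ^+ 2) =
    gamma * alpha * q * q + (q + q ^+ 2 - q ^+ 3).
  by field; rewrite !gt_eqF.
have q1 : q <= 1 by rewrite gerBl.
have h1 : gamma * alpha * q * q <= gamma * alpha * q.
  by rewrite ler_piMr // !mulr_ge0 // ltW.
(* This product is 1 - q - q^2 + q^3, the slack left besides the terms in alpha. *)
have : 0 <= (1 - q) ^+ 2 * (1 + q) by rewrite mulr_ge0 ?sqr_ge0 //; lra.
rewrite !expr2 exprS expr2; lra.
Qed.

Lemma ratio1_gt0 (R : realType) (gamma alpha eps : R) : 0 < gamma -> 0 <= eps < 1 ->
  0 <= alpha -> 0 < ratio1 gamma alpha eps.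
Proof.
move=> g0 /andP[e0 e1] a0; have q0 : 0 < 1 - eps by rewrite subr_gt0.
rewrite divr_gt0 ?mulr_gt0 ?exprn_gt0 //.
by rewrite ltr_pwDl // !mulr_ge0 // ltW.
Qed.

Lemma greedy_ratio_gt0 (R : realType) (kappa alpha : R) n j :
  0 < kappa <= 1 -> 0 <= alpha <= 1 -> (0 < n)%N -> (0 < j)%N ->
  0 < greedy_ratio kappa alpha n j.
Proof.
move=> /andP[k0 k1] a01 n0; case: j => // j _.
have k01 : 0 <= kappa <= 1 by rewrite ltW.
rewrite greedy_ratioS ltr_pwDl // ?divr_gt0 ?ltr0n // mulr_ge0 //.
  by have /andP[] := discount_bounds k01 a01 n.
exact: greedy_ratio_ge0.
Qed.

Lemma returned_approximation (R : realType) (X : pm_instance R)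
    (gamma alpha eps : R) ord (st : thr_state X) :
  0 <= eps <= 1 -> is_dr_ratio X gamma -> is_curvature X alpha ->
  scan_orders ord -> thr_returns eps ord st ->
  approx_solution
    (Order.min ((ratio1 gamma alpha eps)%:E^-1)
               ((ratio2 X gamma alpha eps)%:E^-1))%E (sol st).
Proof.
move=> eps01 [/andP[g0 g1] dr _] [a01 cu _] ordP ret.
have [r runE stop] := ret.
have [l] := run_trace eps01 ordP r; rewrite runE => tr.
split=> [|O [feas _]]; first exact: trace_feasible tr.
have [eps0 eps1] := andP eps01; have [a0 a1] := andP a01.
(* Both ratios are then 0, with inverse [+oo]. *)
have [z|nz] := eqVneq (gamma * (1 - eps)) 0.
  left; have -> : ratio1 gamma alpha eps = 0.
    by rewrite /ratio1 expr2 mulrA z !mul0r.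
  have -> : ratio2 X gamma alpha eps = 0.
    by rewrite ratio2E /greedy_ratio z !mul0r.
  by rewrite inver eqxx minxx.
move: nz; rewrite mulf_eq0 negb_or => /andP[gnz qnz].
have gpos : 0 < gamma by rewrite lt_def gnz.
have qpos : 0 < 1 - eps by rewrite lt_def qnz subr_ge0.
have e1 : eps < 1 by rewrite -subr_gt0.
have e01 : 0 <= eps < 1 by rewrite eps0.
have first := returned_sol_ge eps01 ordP ret.
have r1 := ratio1_gt0 gpos e01 a0.
have k01 : 0 < gamma * (1 - eps) <= 1.
  by rewrite mulr_gt0 //= mulr_ile1 ?(ltW qpos) // gerBl.
have r2 := greedy_ratio_gt0 k01 a01 (total_budget_gt0 X) (min_budget_gt0 X).
have B1 := optimum_le_all_parts gpos g1 a01 eps0 e1 dr cu tr stop first feas.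
have B2 := optimum_le_greedy gpos g1 a01 eps0 e1 dr cu tr stop first feas.
rewrite ratio2E !inver !gt_eqF //.
right; rewrite /Order.min; case: ifP => _; rewrite -EFinM lee_fin.
  apply: le_trans B1 _; apply: ler_wpM2r; first exact: objective_ge0.
  exact: ratio1_le.
by rewrite mulrC ler_pdivlMr // mulrC.
Qed.

(** [b0] makes b exceed both e and 1 / eps, so 1 <= ln b and ln (b / eps) <= 2 ln b. Then 3 + ln (b
    / eps) / eps <= 5 ln b / eps, and the factor 2 n gives the constant 10. *)
Lemma queries_le_uniform (R : realType) (eps : R) : 0 < eps <= 1 ->
  exists b0 : nat, thr_queries_le 10 eps b0.
Proof.
move=> /andP[e0 e1].
exists (Num.truncn (expR 1 + eps^-1)).+1 => X ord st bb ordP ret.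
have eps01 : 0 <= eps <= 1 by rewrite ltW.
apply: le_trans (queries_returned_le eps01 ordP e0 ret) _.
set n : R := #|ground X|%:R; have n0 : 0 <= n by exact: ler0n.
set b : R := (total_budget X)%:R.
have bgt : expR 1 + eps^-1 < b.
  by apply: lt_le_trans (truncnS_gt _) _; rewrite ler_nat.
have ei : 0 < eps^-1 by rewrite invr_gt0.
have ex := expR_gt0 (1 : R).
have b0 : 0 < b by lra.
have lb1 : 1 <= ln b.
  by rewrite -[1]expRK ler_ln ?posrE //; lra.
have lbe : ln (b / eps) <= 2 * ln b.
  rewrite lnM ?posrE // mulr_natl mulr2n lerD2l ler_ln ?posrE //; lra.
have key : 3 + ln (b / eps) / eps <= 5 * (ln b / eps).
  have h1 : ln (b / eps) / eps <= 2 * ln b / eps by rewrite ler_wpM2r // ltW.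
  have h2 : 1 <= ln b / eps by rewrite ler_pdivlMr // mul1r (le_trans e1).
  rewrite -mulrA in h1; lra.
have -> : 10 * (n / eps) * ln b = 2 * n * (5 * (ln b / eps)) by ring.
by apply: ler_wpM2l => //; rewrite mulr_ge0.
Qed.

(** Since ln b >= ln 2, the constant 3 + ln (1 / eps) is absorbed at the price of a [C] depending on
    [eps]. At b = 1 the logarithm vanishes, so 2 is the least possible start. *)
Lemma queries_le_from_two (R : realType) (eps : R) : 0 < eps <= 1 ->
  exists2 C : R, 0 < C & thr_queries_le C eps 2.
Proof.
move=> /andP[e0 e1]; have ln2 : 0 < ln 2 :> R by rewrite ln_gt0 // ltr1n.
have L0 : 0 <= ln eps^-1 by rewrite ln_ge0 // invf_ge1.
have q0 : 0 <= (3 + ln eps^-1) / ln 2 by rewrite divr_ge0 ?addr_ge0 // ltW.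
exists (2 * ((3 + ln eps^-1) / ln 2 + 1)); first by lra.
move=> X ord st bb ordP ret.
have eps01 : 0 <= eps <= 1 by rewrite ltW.
apply: le_trans (queries_returned_le eps01 ordP e0 ret) _.
set n : R := #|ground X|%:R; have n0 : 0 <= n by exact: ler0n.
set b : R := (total_budget X)%:R.
have b2 : 2 <= b by rewrite ler_nat.
have b0 : 0 < b by lra.
have lb : ln 2 <= ln b by rewrite ler_ln ?posrE //; lra.
have -> : ln (b / eps) = ln b + ln eps^-1 by rewrite lnM ?posrE // invr_gt0.
have key : 3 + (ln b + ln eps^-1) / eps <=
    ((3 + ln eps^-1) / ln 2 + 1) * (ln b / eps).
  have h1 : 3 + ln eps^-1 <= (3 + ln eps^-1) / ln 2 * ln b.
    rewrite -[X in X <= _]mulr1 -[leRHS]mulrA; apply: ler_wpM2l; first lra.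
    by rewrite mulrC ler_pdivlMr // mul1r.
  have h2 : 3 <= 3 / eps by rewrite ler_pdivlMr //; lra.
  have h3 : (3 + ln eps^-1) / eps <= (3 + ln eps^-1) / ln 2 * ln b / eps.
    by rewrite ler_wpM2r // invr_ge0 ltW.
  move: h3; set A := (3 + ln eps^-1) / ln 2.
  by rewrite !mulrDl mul1r mulrA; lra.
have -> : 2 * ((3 + ln eps^-1) / ln 2 + 1) * (n / eps) * ln b =
    2 * n * (((3 + ln eps^-1) / ln 2 + 1) * (ln b / eps)) by ring.
by apply: ler_wpM2l => //; rewrite mulr_ge0.
Qed.

Theorem theorem4 (R : realType) :
  (forall (X : pm_instance R) (gamma alpha eps : R)
      (ord : nat -> seq ('I_(nparts X) * ground X)),
    0 <= eps <= 1 -> is_dr_ratio X gamma -> is_curvature X alpha ->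
    scan_orders ord ->
    (forall st : thr_state X, thr_returns eps ord st ->
      approx_solution
        (Order.min ((ratio1 gamma alpha eps)%:E^-1)
                   ((ratio2 X gamma alpha eps)%:E^-1))%E (sol st)) /\
    (0 < eps -> exists st : thr_state X, thr_returns eps ord st))
  /\ (exists2 C : R, 0 < C &
        forall eps : R, 0 < eps <= 1 -> exists b0 : nat, thr_queries_le C eps b0)
  /\ (forall eps : R, 0 < eps <= 1 ->
        exists2 C : R, 0 < C & thr_queries_le C eps 2).
Proof.
split; last split.
- move=> X gamma alpha eps ord eps01 dr cu ordP; split=> [st|].
    exact: returned_approximation.
  exact: run_terminates.
- by exists 10 => // eps; exact: queries_le_uniform.
- by move=> eps; exact: queries_le_from_two.
Qed.
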